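(* Let $0<c<1$ and let $\alpha,\beta$ be real with $\alpha+\beta\notin\{-2,-4,-6,\dots\}$. For each positive integer $N$ let $r_2=r_2(N)$, $r_3=r_3(N)$ and $h=h(N)$ be real numbers such that $r_2=-N-1$ if $N$ is even, $r_3=N+1$ if $N$ is odd, and such that, as $N\to\infty$, $$r_3\to+\infty,\quad r_2\to-\infty,\quad h\to0,\quad 2hr_2\to c+1,\quad 2hr_3\to c-1.$$ Let $\hat W_n(x)$ be the monic Bannai–Ito polynomials with parameters $\theta_0=1$, $h$, $r_1=\alpha$, $r_2$, $r_3$, $s^*=-\alpha-\beta$. Then for every fixed $n\ge0$ the polynomial $\hat W_n(x)$ converges (coefficientwise) as $N\to\infty$ to the monic big $-1$ Jacobi polynomial $P_n^{(-1)}(x)$ with parameters $\alpha,\beta,c$.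
   Context: The monic Bannai–Ito polynomials with parameters $\theta_0,h,r_1,r_2,r_3,s^*$ are defined by $\hat W_{-1}=0$, $\hat W_0=1$ and $$\hat W_{n+1}(x)+(\theta_0-A_n^{BI}-C_n^{BI})\hat W_n(x)+A_{n-1}^{BI}C_n^{BI}\hat W_{n-1}(x)=x\hat W_n(x),$$ where $$A_n^{BI}=\begin{cases}\frac{2h(n+1+r_1)(n+1+r_2)}{2n+2-s^*},& n\text{ even},\\ \frac{2h(n+1-s^* )(n+1-r_3)}{2n+2-s^*},& n\text{ odd},\end{cases}\qquad C_n^{BI}=\begin{cases}-\frac{2hn(n-s^*+r_3)}{2n-s^*},& n\text{ even},\\ -\frac{2h(n-r_1-s^* )(n-r_2-s^* )}{2n-s^*},& n\text{ odd},\end{cases}$$ with $C_0^{BI}=0$. (A further parameter $s$, given by $s+s^*=r_3-r_1-r_2$, determines the orthogonality grid but does not enter the recurrence.) The monic big $-1$ Jacobi polynomials $P_n^{(-1)}(x)$ with parameters $\alpha,\beta,c$ are defined by $P_{-1}^{(-1)}=0$, $P_0^{(-1)}=1$ and $$P_{n+1}^{(-1)}(x)+(1-A_n-C_n)P_n^{(-1)}(x)+A_{n-1}C_nP_{n-1}^{(-1)}(x)=xP_n^{(-1)}(x),$$ where $$A_n=\begin{cases}\frac{(c+1)(\alpha+n+1)}{\alpha+\beta+2n+2},& n\text{ even},\\ \frac{(1-c)(\alpha+\beta+n+1)}{\alpha+\beta+2n+2},& n\text{ odd},\end{cases}\qquad C_n=\begin{cases}\frac{(1-c)n}{\alpha+\beta+2n},&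 n\text{ even},\\ \frac{(1+c)(\beta+n)}{\alpha+\beta+2n},& n\text{ odd},\end{cases}$$ with $C_0=0$. *)

(* Defs.v *)
From mathcomp Require Import all_boot all_order all_algebra.

Set Implicit Arguments.
Unset Strict Implicit.
Unset Printing Implicit Defensive.

Import Order.TTheory GRing.Theory Num.Theory.

Local Open Scope ring_scope.

(* The solution of
     W_(n+1) + (theta0 - A_n - C_n) W_n + A_(n-1) C_n W_(n-1) = x W_n,
   W_(-1) = 0, W_0 = 1.  Since W_(-1) = 0, the value A_(-1) plays no role. *)
Fixpoint monic_recurrence (R : fieldType) (theta0 : R) (A C : nat -> R)
    (n : nat) : {poly R} :=
  match n with
  | 0 => 1
  | n'.+1 =>
    ('X - (theta0 - A n' - C n')%:P) * monic_recurrence theta0 A C n' -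
    match n' with
    | 0 => 0
    | m.+1 => (A m * C n') *: monic_recurrence theta0 A C m
    end
  end.

Definition bannai_ito_A (R : fieldType) (h r1 r2 r3 sstar : R) (n : nat) : R :=
  if odd n then
    2 * h * (n%:R + 1 - sstar) * (n%:R + 1 - r3) / (2 * n%:R + 2 - sstar)
  else
    2 * h * (n%:R + 1 + r1) * (n%:R + 1 + r2) / (2 * n%:R + 2 - sstar).

(* The value at n = 0 is a convention of its own: the general formula has
   denominator - sstar there, which may vanish. *)
Definition bannai_ito_C (R : fieldType) (h r1 r2 r3 sstar : R) (n : nat) : R :=
  if n == 0%N then 0
  else if odd n then
    - (2 * h * (n%:R - r1 - sstar) * (n%:R - r2 - sstar) / (2 * n%:R - sstar))
  else
    - (2 * h * n%:R * (n%:R - sstar + r3) / (2 * n%:R - sstar)).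

Definition bannai_ito (R : fieldType) (theta0 h r1 r2 r3 sstar : R) (n : nat) :
    {poly R} :=
  monic_recurrence theta0
    (bannai_ito_A h r1 r2 r3 sstar) (bannai_ito_C h r1 r2 r3 sstar) n.

Definition big_m1_jacobi_A (R : fieldType) (alpha beta c : R) (n : nat) : R :=
  if odd n then
    (1 - c) * (alpha + beta + n%:R + 1) / (alpha + beta + 2 * n%:R + 2)
  else
    (c + 1) * (alpha + n%:R + 1) / (alpha + beta + 2 * n%:R + 2).

Definition big_m1_jacobi_C (R : fieldType) (alpha beta c : R) (n : nat) : R :=
  if n == 0%N then 0
  else if odd n then
    (1 + c) * (beta + n%:R) / (alpha + beta + 2 * n%:R)
  else
    (1 - c) * n%:R / (alpha + beta + 2 * n%:R).

Definition big_m1_jacobi (R : fieldType) (alpha beta c : R) (n : nat) :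
    {poly R} :=
  monic_recurrence 1
    (big_m1_jacobi_A alpha beta c) (big_m1_jacobi_C alpha beta c) n.

(* Main.v *)
Require Import Defs.
From mathcomp Require Import all_boot all_order all_algebra.
From mathcomp Require Import all_classical all_reals all_analysis.
From mathcomp Require Import ring.

(** For [n > 0], as well as for [A] at [n = 0], each Bannai-Ito recurrence
    coefficient is, up to sign, a factor [2 * h * (a + r)] with [r] either [r2] or
    [r3], times an expression independent of [h], [r2] and [r3].  The
    denominator in that expression is that of the corresponding big -1 Jacobi
    coefficient, because [sstar = - alpha - beta].  As [h] tends to 0, the shift
    [a] disappears in the limit ([cvg_scaled_shift]): the factor tends to [c + 1]
    when [r] is [r2] and to [c - 1] when [r] is [r3], so the recurrence
    coefficients converge to those of the big -1 Jacobi polynomials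
    ([cvg_bannai_ito_A], [cvg_bannai_ito_C]).  The coefficients of the [n]-th
    monic polynomial are polynomial expressions in finitely many recurrence
    coefficients, hence they converge as well ([cvg_monic_recurrence]). *)

Set Implicit Arguments.
Unset Strict Implicit.
Unset Printing Implicit Defensive.

Import Order.TTheory GRing.Theory Num.Theory.
Import numFieldNormedType.Exports.

Local Open Scope classical_set_scope.
Local Open Scope ring_scope.

(** Two-step induction along the recurrence: convergence of one polynomial needs
    that of the two preceding ones. *)
Lemma cvg_monic_recurrence (R : realType) (theta0 : R) (A C : nat -> nat -> R)
  (A' C' : nat -> R)
  (cvgA : forall n, A N n @[N --> \oo] --> A' n)
  (cvgC : forall n, C N n @[N --> \oo] --> C' n) (n k : nat) :
  (monic_recurrence theta0 (A N) (C N) n)`_k @[N --> \oo]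
    --> (monic_recurrence theta0 A' C' n)`_k.
Proof.
have cvg_step m (P Q : nat -> {poly R}) (P' Q' : {poly R}) :
    (forall j, (P N)`_j @[N --> \oo] --> P'`_j) ->
    (forall j, (Q N)`_j @[N --> \oo] --> Q'`_j) ->
    forall j, (('X - (theta0 - A N m - C N m)%:P) * P N - Q N)`_j @[N --> \oo]
      --> (('X - (theta0 - A' m - C' m)%:P) * P' - Q')`_j.
  move=> cvgP cvgQ j; rewrite mulrBl !coefB coefXM coefCM.
  under eq_fun do rewrite mulrBl !coefB coefXM coefCM.
  apply: cvgB (cvgQ j); apply: cvgB.
    by case: (j == 0%N); [exact: cvg_cst | exact: cvgP].
  apply: cvgM (cvgP j).
  by apply: cvgB (cvgC m); apply: cvgB (cvgA m); exact: cvg_cst.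
suff: (forall j, (monic_recurrence theta0 (A N) (C N) n)`_j @[N --> \oo]
      --> (monic_recurrence theta0 A' C' n)`_j) /\
    (forall j, (monic_recurrence theta0 (A N) (C N) n.+1)`_j @[N --> \oo]
      --> (monic_recurrence theta0 A' C' n.+1)`_j).
  by case.
elim: n => [|n [IHn IHn1]]; split=> //.
- by move=> j /=; exact: cvg_cst.
- by apply: (cvg_step 0%N (fun=> 1) (fun=> 0)) => j; exact: cvg_cst.
- apply: (cvg_step n.+1 _ (fun N =>
    (A N n * C N n.+1) *: monic_recurrence theta0 (A N) (C N) n)) => // j.
  rewrite coefZ.
  under eq_fun do rewrite coefZ.
  by apply: cvgM (IHn j); apply: cvgM.
Qed.

(** The shift [a] contributes [2 * h N * a], which vanishes with [h]. *)
Lemma cvg_scaled_shift (R : realType) (h r : nat -> R) (l a : R)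
  (h_lim : h N @[N --> \oo] --> (0 : R))
  (hr_lim : 2 * h N * r N @[N --> \oo] --> l) :
  2 * h N * (a + r N) @[N --> \oo] --> l.
Proof.
rewrite -[l in _ --> l]add0r -[0](mul0r a) -[0](mulr0 2).
under eq_fun do rewrite mulrDr.
apply: cvgD hr_lim; apply: cvgM; last exact: cvg_cst.
by apply: cvgM h_lim; exact: cvg_cst.
Qed.

Lemma cvg_bannai_ito_A (R : realType) (alpha beta c : R) (r2 r3 h : nat -> R)
  (h_lim : h N @[N --> \oo] --> (0 : R))
  (hr2_lim : 2 * h N * r2 N @[N --> \oo] --> c + 1)
  (hr3_lim : 2 * h N * r3 N @[N --> \oo] --> c - 1) (n : nat) :
  bannai_ito_A (h N) alpha (r2 N) (r3 N) (- alpha - beta) n @[N --> \oo]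
    --> big_m1_jacobi_A alpha beta c n.
Proof.
have denE : 2 * n%:R + 2 - (- alpha - beta) = alpha + beta + 2 * n%:R + 2 by ring.
rewrite /bannai_ito_A /big_m1_jacobi_A denE; case: (odd n).
- rewrite (_ : (1 - c) * _ = - (c - 1) * (alpha + beta + n%:R + 1)); last by ring.
  have numE N : 2 * h N * (n%:R + 1 - (- alpha - beta)) * (n%:R + 1 - r3 N) =
    - (2 * h N * (- (n%:R + 1) + r3 N)) * (alpha + beta + n%:R + 1) by ring.
  under eq_fun do rewrite numE.
  apply: cvgM; last exact: cvg_cst.
  apply: cvgM; last exact: cvg_cst.
  by apply: cvgN; exact: cvg_scaled_shift.
- have numE N : 2 * h N * (n%:R + 1 + alpha) * (n%:R + 1 + r2 N) =
    2 * h N * (n%:R + 1 + r2 N) * (alpha + n%:R + 1) by ring.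
  under eq_fun do rewrite numE.
  apply: cvgM; last exact: cvg_cst.
  apply: cvgM; last exact: cvg_cst.
  exact: cvg_scaled_shift.
Qed.

Lemma cvg_bannai_ito_C (R : realType) (alpha beta c : R) (r2 r3 h : nat -> R)
  (h_lim : h N @[N --> \oo] --> (0 : R))
  (hr2_lim : 2 * h N * r2 N @[N --> \oo] --> c + 1)
  (hr3_lim : 2 * h N * r3 N @[N --> \oo] --> c - 1) (n : nat) :
  bannai_ito_C (h N) alpha (r2 N) (r3 N) (- alpha - beta) n @[N --> \oo]
    --> big_m1_jacobi_C alpha beta c n.
Proof.
have denE : 2 * n%:R - (- alpha - beta) = alpha + beta + 2 * n%:R by ring.
rewrite /bannai_ito_C /big_m1_jacobi_C denE.
case: (n == 0%N); first exact: cvg_cst.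
case: (odd n).
- rewrite (_ : (1 + c) * _ = (c + 1) * (beta + n%:R)); last by ring.
  have numE N :
    - (2 * h N * (n%:R - alpha - (- alpha - beta)) *
       (n%:R - r2 N - (- alpha - beta))) =
    2 * h N * (- (n%:R + alpha + beta) + r2 N) * (beta + n%:R) by ring.
  under eq_fun do rewrite -mulNr numE.
  apply: cvgM; last exact: cvg_cst.
  apply: cvgM; last exact: cvg_cst.
  exact: cvg_scaled_shift.
- rewrite (_ : (1 - c) * _ = - (c - 1) * n%:R); last by ring.
  have numE N : - (2 * h N * n%:R * (n%:R - (- alpha - beta) + r3 N)) =
    - (2 * h N * (n%:R + alpha + beta + r3 N)) * n%:R by ring.
  under eq_fun do rewrite -mulNr numE.
  apply: cvgM; last exact: cvg_cst.
  apply: cvgM; last exact: cvg_cst.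
  by apply: cvgN; exact: cvg_scaled_shift.
Qed.

Theorem mainTheorem5 (R : realType) (alpha beta c : R) (r2 r3 h : nat -> R)
  (c_gt0 : 0 < c) (c_lt1 : c < 1)
  (alpha_beta : forall k : nat, alpha + beta <> - (2 * k.+1)%:R)
  (r2_even : forall N : nat, (0 < N)%N -> ~~ odd N -> r2 N = - N%:R - 1)
  (r3_odd : forall N : nat, (0 < N)%N -> odd N -> r3 N = N%:R + 1)
  (r3_lim : r3 N @[N --> \oo] --> +oo)
  (r2_lim : r2 N @[N --> \oo] --> -oo)
  (h_lim : h N @[N --> \oo] --> (0 : R))
  (hr2_lim : 2 * h N * r2 N @[N --> \oo] --> c + 1)
  (hr3_lim : 2 * h N * r3 N @[N --> \oo] --> c - 1)
  (n : nat) :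
  forall k : nat,
    (bannai_ito 1 (h N) alpha (r2 N) (r3 N) (- alpha - beta) n)`_k
      @[N --> \oo] --> (big_m1_jacobi alpha beta c n)`_k.
Proof.
move=> k; apply: cvg_monic_recurrence => m.
- exact: cvg_bannai_ito_A.
- exact: cvg_bannai_ito_C.
Qed.
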